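(* Let $p$ be an odd prime and order the elements of the $p$-element cyclic group $\mathbb{Z}_p$ as $x_1, \ldots, x_p$, where $$x_{2i} = \frac{p-1}{2} + i \qquad\text{and}\qquad x_{2i+1} = \frac{p-1}{2} - i$$ (for all integers $i \ge 0$ for which the index lies in $\{1,\ldots,p\}$). Then for every $A \subseteq \mathbb{Z}_p$ with $a$ elements, $$\mathrm{ST}(A) \ge \mathrm{ST}(\{x_1, \ldots, x_a\}) = \begin{cases} 0, & \text{if } a \le \frac{p+1}{3},\\ \left\lfloor \frac{3a-p}{2} \right\rfloor \left\lceil \frac{3a-p}{2} \right\rceil, & \text{if } a > \frac{p+1}{3}. \end{cases}$$ Moreover, if $\mathrm{ST}(\{x_1, \ldots, x_a\}) > 0$, then the equality $\mathrm{ST}(A) = \mathrm{ST}(\{x_1,\ldots,x_a\})$ holds only if $A = \varphi(\{x_1, \ldots, x_a\})$ for some $\varphi \in \mathrm{Aut}(\mathbb{Z}_p)$, that is, only if $A = \xi \cdot \{x_1, \ldots, x_a\}$ for some nonzero $\xi \in \mathbb{Z}_p$.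
   Context: For a subset $A$ of a finite abelian group, $\mathrm{ST}(A) = |\{(x,y,z) \in A^3 : x+y=z\}|$ is the number of (ordered) Schur triples contained in $A$; the elements $x,y,z$ need not be distinct, and if $x \ne y$ then $(x,y,z)$ and $(y,x,z)$ count as different triples. *)

(* Defs.v *)
From HB Require Import structures.
From mathcomp Require Import all_boot all_order all_algebra all_fingroup.

Set Implicit Arguments.
Unset Strict Implicit.
Unset Printing Implicit Defensive.

Import Order.TTheory GRing.Theory Num.Theory.
Local Open Scope ring_scope.

Definition ST (G : finZmodType) (A : {set G}) : nat :=
  #|[set t : G * G * G | [&& t.1.1 \in A, t.1.2 \in A, t.2 \in A
                           & t.1.1 + t.1.2 == t.2]]|.

(* Indices start at 1: for k = 2i this is (p-1)/2 + i and for k = 2i+1 it is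
   (p-1)/2 - i, since k./2 = i in both cases. *)
Definition xelt (p k : nat) : 'Z_p :=
  if odd k then (p.-1)./2%:R - k./2%:R else (p.-1)./2%:R + k./2%:R.

(* {x_1, ..., x_a} *)
Definition initial_set (p a : nat) : {set 'Z_p} :=
  [set xelt p i.+1 | i : 'I_a].

(* Main.v *)
Require Import Defs.
From HB Require Import structures.
From mathcomp Require Import all_boot all_order all_algebra all_fingroup.
From mathcomp Require Import cyclic zify lra.

Set Implicit Arguments.
Unset Strict Implicit.
Unset Printing Implicit Defensive.

Import Order.TTheory GRing.Theory Num.Theory.
Local Open Scope ring_scope.

(** Write [B] for the complement of [A], with [b = p - a] elements.
Inclusion-exclusion gives [ST A + ST B + a * b = a ^ 2 + b ^ 2] ([ST_setC]), so
few Schur triples in [A] means many in [B]; the complement of [initial_set p a]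
is [alt_set p b = {0, -1, 1, -2, 2, ...}], an interval of length [b] around
[0]. When [3 * a <= p + 1] the initial set is sum-free, and otherwise
[3 * b + 2 <= 2 * p]; only this second range needs an argument.

The key quantity is [dist B g], the size of [B] minus [B + g]. It is symmetric
and subadditive in [g], vanishes only at [0] (if [B] is nonempty and proper),
and, on writing a triple [x + y = z] as [z - y = x], satisfies
[ST B = b ^ 2 - \sum_(g in B) dist B g] ([ST_dist]). Pollard's theorem
([pollard]), applied to [B] and [- B], says that few [g] are close to [0]:
[\sum_g (m - dist B g) <= m ^ 2] with truncated subtraction, that is, the balls
[dball B k] for [k < m] have total size at most [m ^ 2], what they would have if
the [k]-th ball had [2 * k + 1] points ([sum_subn_dist_le], [sum_dball]). The
choice [m = ceil (b / 2)] yields [m * (b - m) <= \sum_(g in B) dist B g].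
The interval attains this bound since in it the [dist] of [+- n] is at most [n]
([dist_alt_set]); this gives the minimum and its value.

In the case of equality, with [t = m - 1] positive, the balls of radius
[k <= t] have total size exactly [(t + 1) ^ 2], and the set [B] lies between the
balls of radius [t] and [t + 1], which have [2 * t + 1] and at most [2 * t + 3]
points. By subadditivity the balls of radii [k] and [t - k] add up into the ball
of radius [t], so Cauchy-Davenport bounds the sum of their sizes by [2 * t + 2];
summing over [k] shows that all these bounds are equalities. If [j + 1] is the
first radius whose ball contains some [x != 0], then the ball of radius [j] is
trivial, so the ball of radius [t - j] already has the size of the ball of radius
[t]. Translation by [x] thus maps the ball of radius [t] into the ball of radius
[t + 1], which has at most two more points. A symmetric set that grows so little
under translation by [x] is the progression of all [i * x] with
[-t <= i <= t] ([sym_eq_symprog], [dball_symprog]). Hence [B] is a dilate of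
[alt_set p b] ([sum_dist_eq]; the case [t = 0] is immediate), and [A] is the
same dilate of [initial_set p a]. *)

(** * Representation counts and Pollard's theorem *)

Section Reps.
Variable G : finZmodType.
Implicit Types (X Y Z : {set G}) (g h : G).

Definition reps X Y g : nat := (\sum_x (x \in X) * ((g - x)%R \in Y))%N.

Definition shift g X : {set G} := [set x | x - g \in X].

Lemma card_shift g X : #|shift g X| = #|X|.
Proof.
rewrite -(card_imset (mem X) (addIr g)); apply: eq_card => x; rewrite inE.
by apply/idP/imsetP => [xX|[y yX ->]];
  [exists (x - g); rewrite ?subrK | rewrite addrK].
Qed.

Lemma reps_sym X Y g : reps X Y g = reps Y X g.
Proof.
rewrite /reps (reindex_inj (inv_inj (subKr g))).
by apply: eq_bigr => x _; rewrite subKr mulnC.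
Qed.

Lemma repsUl X Y Z g :
  [disjoint X & Y] -> reps (X :|: Y) Z g = (reps X Z g + reps Y Z g)%N.
Proof.
move=> /pred0P dXY; rewrite /reps -big_split; apply: eq_bigr => x _ /=.
by have := dXY x; rewrite /= inE; case: (x \in X); case: (x \in Y) => //= _;
  rewrite ?mul0n ?addn0.
Qed.

Lemma repsUr X Y Z g :
  [disjoint Y & Z] -> reps X (Y :|: Z) g = (reps X Y g + reps X Z g)%N.
Proof. by move=> dYZ; rewrite reps_sym repsUl // !(reps_sym _ X). Qed.

Lemma reps_shift X Y g h : reps X (shift h Y) g = reps X Y (g - h)%R.
Proof. by apply: eq_bigr => x _; rewrite inE addrAC. Qed.

Lemma sum_mem_sub Y h : (\sum_g ((g - h)%R \in Y) = #|Y|)%N.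
Proof.
rewrite -(card_shift h Y) -sum1_card [RHS]big_mkcond /=.
by apply: eq_bigr => g _; rewrite inE; case: ifP.
Qed.

Lemma sum_reps X Y : (\sum_g reps X Y g = #|X| * #|Y|)%N.
Proof.
rewrite exchange_big -sum1_card big_distrl /= [RHS]big_mkcond /=.
apply: eq_bigr => x _; rewrite -big_distrr /= sum_mem_sub.
by case: (x \in X); rewrite ?mul1n ?mul0n.
Qed.

Lemma leq_reps X Y g : (reps X Y g <= #|X|)%N.
Proof.
rewrite -sum1_card [leqRHS]big_mkcond; apply: leq_sum => x _.
by case: (x \in X); case: (_ \in Y).
Qed.

End Reps.

Section Prime.
Variable G : finZmodType.
Hypothesis prime_G : prime #|G|.
Implicit Types (X Y Z : {set G}) (g h x : G).

Lemma mulrn_surj x g : x != 0 -> exists n, g = x *+ n.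
Proof.
move=> nz_x; have: (#[x]%g %| #|[set: G]|)%N by apply: (cardSg (subsetT <[x]>%G)).
rewrite cardsT; case/primeP: prime_G => _ /[apply] /pred2P[ox|ox].
  by move: ox => /eqP; rewrite order_eq1 => /eqP x0; case/eqP: nz_x.
have: g \in <[x]>%g.
  suff -> : <[x]>%g = [set: G] by rewrite inE.
  by apply/eqP; rewrite eqEcard subsetT cardsT -ox /order leqnn.
by case/cycleP => n ->; exists n; rewrite FinRing.zmodXgE.
Qed.

(** In a group of prime order every nonzero [x] generates, so no nonempty proper
subset is closed under translation by [x]. *)
Lemma closed_translate X x :
  x != 0 -> X != set0 -> {in X, forall y, y + x \in X} -> X = setT.
Proof.
move=> nz_x /set0Pn[y yX] clX; apply/setP=> g; rewrite inE.
have [n def_g] := mulrn_surj (g - y) nz_x.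
rewrite -(subrK y g) def_g addrC; elim: n {def_g} => [|n IHn].
  by rewrite addr0.
by rewrite mulrSr addrA clX.
Qed.

(** Pollard's theorem, by Dyson's transform. Translating [Y] so that it meets [X]
without being contained in it, the pair [(X, Y)] is traded for the union [U] and
intersection [I], and the pair of differences. Since
[1_X * 1_Y = 1_U * 1_I + 1_(X \ Y) * 1_(Y \ X)] as convolutions, truncation at
[s] can be distributed over both terms. Both new pairs have a smaller second
member and inherit the size hypotheses, so induction on [#|Y|] applies. *)
Lemma pollard X Y s :
  (s <= #|X|)%N -> (s <= #|Y|)%N -> (#|X| + #|Y| <= #|G| + s)%N ->
  (s * (#|X| + #|Y| - s) <= \sum_g minn s (reps X Y g))%N.
Proof.
have [k] := ubnP #|Y|; elim: k => // k IHk in X Y s *.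
rewrite ltnS => leYk sX sY sG.
have [->|s_gt0] := posnP s; first by rewrite mul0n.
(* Truncation at [#|Y|] has no effect, and the total count is known. *)
have [eq_s|ne_s] := eqVneq s #|Y|.
  rewrite eq_s addnK mulnC -sum_reps; apply: leq_sum => g _.
  by rewrite leq_min leqnn andbT reps_sym leq_reps.
have lt_s : (s < #|Y|)%N by rewrite ltn_neqAle ne_s.
have [y1 [y2 [y1Y y2Y ne_y]]] : exists y1 y2, [/\ y1 \in Y, y2 \in Y & y1 != y2].
  apply/card_gt1P; exact: leq_ltn_trans lt_s.
have [x1 x1X] : exists x1, x1 \in X by apply/card_gt0P; apply: leq_trans sX.
(* Otherwise [X] would be closed under translation by [y2 - y1]. *)
have [h [z1 [z2 [z1X z1Y z2X z2Y]]]] : exists h z1 z2, [/\ z1 \in X, z1 \in shift h Y,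
    z2 \notin X & z2 \in shift h Y].
  have ne_X : X != setT.
    by apply: contraTneq lt_s => XT; move: sG; rewrite XT cardsT leq_add2l leqNgt.
  have nz : y2 - y1 != 0 by rewrite subr_eq0 eq_sym.
  have /exists_inP[z zX nz_z] : [exists z in X, z + (y2 - y1) \notin X].
    apply: contraNT ne_X; rewrite negb_exists_in => /forall_inP clX.
    apply/eqP; apply: (closed_translate nz); first by apply/set0Pn; exists x1.
    by move=> z /clX; rewrite negbK.
  exists (z - y1), z, (z + (y2 - y1)); split=> //; rewrite inE.
    by rewrite opprB addrC subrK.
  by rewrite addrC opprB addrA subrK addrC subrK.
pose Y' := shift h Y; pose I := X :&: Y'; pose U := X :|: Y'.
have -> : (\sum_g minn s (reps X Y g) = \sum_g minn s (reps X Y' g))%N.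
  rewrite (reindex_inj (addIr (- h))).
  by apply: eq_bigr => g _; rewrite reps_shift.
have cY' : #|Y'| = #|Y| by apply: card_shift.
have I_gt0 : (0 < #|I|)%N by apply/card_gt0P; exists z1; rewrite inE z1X.
have I_lt : (#|I| < #|Y|)%N.
  rewrite -cY'; apply: proper_card; apply/properP; split; first exact: subsetIr.
  by exists z2; rewrite // inE (negPf z2X).
have cUI : (#|U| + #|I| = #|X| + #|Y|)%N by rewrite cardsUI cY'.
have cX : (#|X :\: Y'| + #|I| = #|X|)%N by rewrite addnC cardsID.
have cY : (#|Y' :\: X| + #|I| = #|Y|)%N by rewrite addnC /I setIC cardsID.
have repsE g : reps X Y' g = (reps U I g + reps (X :\: Y') (Y' :\: X) g)%N.
  have dX : [disjoint I & X :\: Y'].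
    by rewrite -setI_eq0; apply/eqP/setP=> z; rewrite !inE; do 2!case: (_ \in _).
  have dY : [disjoint I & Y' :\: X].
    by rewrite -setI_eq0; apply/eqP/setP=> z; rewrite !inE; do 2!case: (_ \in _).
  have dU : [disjoint X & Y' :\: X].
    by rewrite -setI_eq0; apply/eqP/setP=> z; rewrite !inE; do 2!case: (_ \in _).
  have {1}-> : Y' = I :|: (Y' :\: X) by rewrite /I setIC setID.
  have -> : U = X :|: (Y' :\: X).
    by apply/setP=> z; rewrite !inE; do 2!case: (_ \in _).
  rewrite repsUr // repsUl // -addnA; congr (_ + _)%N.
  by rewrite -{1}(setID X Y') repsUl // [reps I _ g]reps_sym.
clearbody U I Y'; clear z1X z1Y z2X z2Y ne_y y1Y y2Y x1X ne_s lt_s.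
(* If [s <= #|I|], the pair [(U, I)] alone suffices. Otherwise its counts are at
   most [#|I|], hence unaffected, and [s - #|I|] remains for the differences. *)
have [le_sI|lt_Is] := leqP s #|I|.
  rewrite -cUI; apply: leq_trans (_ : \sum_g minn s (reps U I g) <= _)%N.
    by apply: IHk; lia.
  by apply: leq_sum => g _; rewrite repsE; lia.
have IH2 : ((s - #|I|) * (#|X :\: Y'| + #|Y' :\: X| - (s - #|I|)) <=
    \sum_g minn (s - #|I|) (reps (X :\: Y') (Y' :\: X) g))%N.
  by apply: IHk; lia.
have H1 : (\sum_g (reps U I g + minn (s - #|I|) (reps (X :\: Y') (Y' :\: X) g)) <=
   \sum_g minn s (reps X Y' g))%N.
  apply: leq_sum => g _; rewrite repsE.
  have : (reps U I g <= #|I|)%N by rewrite reps_sym leq_reps.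
  by lia.
apply: leq_trans H1; rewrite big_split /= sum_reps.
apply: leq_trans (leq_add (leqnn _) IH2).
have cU : #|U| = (#|X :\: Y'| + #|Y' :\: X| + #|I|)%N by lia.
have [e def_s] : exists e, s = (#|I| + e)%N by exists (s - #|I|)%N; lia.
have [w def_w] : exists w, (#|X :\: Y'| + #|Y' :\: X| = w + e)%N.
  by exists (#|X :\: Y'| + #|Y' :\: X| - e)%N; lia.
have -> : (#|X| + #|Y| - s = w + #|I|)%N by lia.
by rewrite cU def_w def_s addKn addnK; lia.
Qed.
End Prime.

(** * The translation distance of a set *)

Section Dist.
Variable G : finZmodType.
Implicit Types (B S X Y Z : {set G}) (g h x : G).

(** The function [g |-> dist B g] behaves as a norm on the group; it is half the
size of the symmetric difference of [B] and [B + g]. *)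
Definition dist B g : nat := #|B :\: shift g B|.

Definition dball B k : {set G} := [set g | dist B g <= k]%N.

Definition oppset B : {set G} := [set x | - x \in B].

Lemma card_oppset B : #|oppset B| = #|B|.
Proof.
rewrite -(card_imset (mem B) (@oppr_inj G)); apply: eq_card => x; rewrite inE.
by apply/idP/imsetP => [xB|[y yB ->]]; [exists (- x); rewrite ?opprK | rewrite opprK].
Qed.

(** This turns Pollard's theorem for the pair [(B, - B)] into a statement about
[dist]. *)
Lemma dist_reps B g : (reps B (oppset B) g + dist B g = #|B|)%N.
Proof.
rewrite -(cardsID (shift g B) B); congr (_ + _)%N.
rewrite -sum1_card [RHS]big_mkcond /=; apply: eq_bigr => x _.
by rewrite !inE opprB; do 2!case: (_ \in B).
Qed.

Lemma dist0 B : dist B 0 = 0%N.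
Proof. by apply/eqP; rewrite cards_eq0 setD_eq0; apply/subsetP=> x; rewrite inE subr0. Qed.

Lemma distN B g : dist B (- g) = dist B g.
Proof.
suff eqI : #|B :&: shift (- g) B| = #|B :&: shift g B|.
  have := cardsID (shift (- g) B) B; have := cardsID (shift g B) B.
  by rewrite eqI /dist; lia.
rewrite -(card_shift g); apply: eq_card => x.
by rewrite !inE opprK subrK andbC.
Qed.

Lemma distD B g h : (dist B (g + h)%R <= dist B g + dist B h)%N.
Proof.
rewrite -[dist B h](card_shift g); apply: leq_trans (leq_card_setU _ _).
apply/subset_leq_card/subsetP => x; rewrite !inE opprD addrA => /andP[-> ->].
by rewrite andbT; case: (_ \in B).
Qed.

Lemma dball_sub B j k : (j <= k)%N -> dball B j \subset dball B k.
Proof. by move=> le_jk; apply/subsetP => g; rewrite !inE => /leq_trans; apply. Qed.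

Lemma dball_opp B k g : g \in dball B k -> - g \in dball B k.
Proof. by rewrite !inE distN. Qed.

Lemma dball_add B j k g h :
  g \in dball B j -> h \in dball B k -> g + h \in dball B (j + k).
Proof. by rewrite !inE => dg dh; apply: leq_trans (distD _ _ _) (leq_add dg dh). Qed.

Lemma dball0 B k : 0 \in dball B k.
Proof. by rewrite inE dist0. Qed.

(** Layer-cake formula: [m - d] counts the radii [k < m] with [d <= k]. *)
Lemma sum_dball B m :
  (\sum_g (m - dist B g) = \sum_(k < m) #|dball B k|)%N.
Proof.
transitivity (\sum_g \sum_(k < m) (dist B g <= k))%N; last first.
  rewrite exchange_big; apply: eq_bigr => k _; rewrite -sum1_card.
  by rewrite [RHS]big_mkcond; apply: eq_bigr => g _; rewrite inE; case: leqP.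
apply: eq_bigr => g _; elim: m => [|m IHm]; first by rewrite big_ord0.
by rewrite big_ord_recr /= -IHm; lia.
Qed.

Definition schur X Y Z : nat :=
  (\sum_x \sum_y (x \in X) * (y \in Y) * ((x + y)%R \in Z))%N.

Lemma ST_schur B : ST B = schur B B B.
Proof.
rewrite /schur pair_big /= /ST.
pose f (u : G * G) := (u, u.1 + u.2).
have f_inj : injective f by move=> u v [].
transitivity #|[set u : G * G | [&& u.1 \in B, u.2 \in B & u.1 + u.2 \in B]]|.
  rewrite -(card_imset _ f_inj); apply: eq_card => -[[x y] z].
  rewrite inE /=; apply/and4P/imsetP => /=.
    case=> xB yB zB /eqP def_z; exists (x, y); first by rewrite inE /= def_z xB yB.
    by rewrite /f /= def_z.
  by case=> -[x' y']; rewrite inE /= => /and3P[? ? ?] [-> -> ->].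
rewrite -sum1_card big_mkcond; apply: eq_bigr => -[x y] _ /=.
by rewrite inE /=; do 3!case: (_ \in B).
Qed.

(** Rewriting [x + y = z] as [z - y = x], the Schur triples with a given [x] in
[B] are counted by the [z] in [B] with [z - x] in [B]. *)
Lemma ST_dist B : (ST B + \sum_(g in B) dist B g = #|B| * #|B|)%N.
Proof.
rewrite -sum_nat_const ST_schur.
transitivity (\sum_(g in B) (reps B (oppset B) g + dist B g))%N; last first.
  by apply: eq_bigr => g _; rewrite dist_reps.
rewrite big_split /=; congr (_ + _)%N.
rewrite [RHS]big_mkcond; apply: eq_bigr => x _; case: ifP => xB /=; last first.
  by rewrite big1.
rewrite (reindex_inj (addIr (- x))) /=; apply: eq_bigr => y _.
by rewrite mul1n mulnC inE opprB [x + _]addrC subrK.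
Qed.

Lemma schurCz X Y Z : (schur X Y Z + schur X Y (~: Z) = #|X| * #|Y|)%N.
Proof.
rewrite -big_split /= -sum1_card big_distrl /= [RHS]big_mkcond.
apply: eq_bigr => x _; rewrite -big_split /= mul1n -sum1_card.
case: ifP => _; last by rewrite big1.
rewrite [RHS]big_mkcond; apply: eq_bigr => y _; rewrite inE.
by do 2!case: (_ \in _).
Qed.

Lemma schurCy X Y Z : (schur X Y Z + schur X (~: Y) Z = #|X| * #|Z|)%N.
Proof.
rewrite -big_split /= -sum1_card big_distrl /= [RHS]big_mkcond.
apply: eq_bigr => x _; rewrite -big_split /= mul1n -sum1_card.
case: ifP => _; last by rewrite big1.
rewrite (reindex_inj (addIr (- x))) [RHS]big_mkcond; apply: eq_bigr => y _.
by rewrite inE [x + _]addrC subrK; do 2!case: (_ \in _).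
Qed.

Lemma schurC X Y Z : schur X Y Z = schur Y X Z.
Proof.
rewrite /schur exchange_big; apply: eq_bigr => y _; apply: eq_bigr => x _.
by rewrite addrC [((x \in X) * _)%N]mulnC.
Qed.

(** Replacing one coordinate by its complement at a time leads from triples in
[~: B] to triples in [B], because any two coordinates determine the third. *)
Lemma ST_setC B :
  (ST (~: B) + ST B + #|~: B| * #|B| = #|~: B| ^ 2 + #|B| ^ 2)%N.
Proof.
have := schurCz (~: B) (~: B) B; have := schurCy (~: B) B B.
have := schurCy B B B; rewrite !ST_schur -!mulnn (schurC B (~: B)).
by set A := ~: B; lia.
Qed.

End Dist.

Section PrimeDist.
Variable G : finZmodType.
Hypothesis prime_G : prime #|G|.
Implicit Types (B S X Y Z : {set G}) (g h x : G).

Lemma dist_eq0 B g : B != set0 -> B != setT -> dist B g = 0%N -> g = 0.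
Proof.
move=> B0 BT /eqP; rewrite cards_eq0 setD_eq0 => /subsetP sB.
apply/eqP; apply: contraNT BT; rewrite -oppr_eq0 => nz_g.
by apply/eqP/(closed_translate prime_G nz_g B0) => y /sB; rewrite inE.
Qed.

(** Pollard's theorem for [B] and [- B] at the level [s = #|B| - m]: since the
counts are [#|B| - dist B g], their excess over [s] is [m - dist B g]. *)
Lemma sum_subn_dist_le B m : (m <= #|B|)%N -> (#|B| + m <= #|G|)%N ->
  (\sum_g (m - dist B g) <= m ^ 2)%N.
Proof.
move=> le_m le_G; pose s := (#|B| - m)%N.
have := @pollard _ prime_G B (oppset B) s.
rewrite card_oppset => /(_ _ _ _) Ps.
have {}Ps : ((#|B| - m) * (#|B| + m) <= \sum_g minn s (reps B (oppset B) g))%N.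
  have -> : (#|B| + m = #|B| + #|B| - s)%N by rewrite /s; lia.
  by apply: Ps; rewrite /s; lia.
have : (\sum_g (m - dist B g) + \sum_g minn s (reps B (oppset B) g) =
        #|B| ^ 2)%N.
  rewrite -mulnn -{2}(card_oppset B) -sum_reps -big_split /=.
  by apply: eq_bigr => g _; have := dist_reps B g; rewrite /s; lia.
move: Ps; rewrite -subn_sqr; set E := (\sum_g minn _ _)%N; set F := (\sum_g (m - _))%N.
by move=> Ps eqE; rewrite -(leq_add2r E) eqE -leq_subLR.
Qed.

(** Summing [m <= (m - dist B g) + dist B g] over [B] and bounding the first part
by the sum over the whole group. Equality forces every inequality used to be
tight, which confines [B] between two consecutive balls. *)
Lemma sum_dist_ge B m : (m <= #|B|)%N -> (#|B| + m <= #|G|)%N ->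
  (m * #|B| <= m ^ 2 + \sum_(g in B) dist B g)%N /\
  ((m * #|B| = m ^ 2 + \sum_(g in B) dist B g)%N ->
   [/\ (\sum_g (m - dist B g) = m ^ 2)%N,
       {in B, forall g, dist B g <= m}%N &
       forall g, g \notin B -> (m <= dist B g)%N]).
Proof.
move=> le_m /(sum_subn_dist_le le_m); rewrite (bigID (mem B)) /=.
set E1 := (\sum_(i in B) _)%N; set E2 := (\sum_(i | i \notin B) _)%N => leE.
have : (m * #|B| + \sum_(g in B) (dist B g - m) =
        E1 + \sum_(g in B) dist B g)%N.
  rewrite mulnC -sum_nat_const -!big_split /=.
  by apply: eq_bigr => g _; lia.
set E3 := (\sum_(g in B) (_ - _))%N; set E := (\sum_(g in B) _)%N => eqE.
move: leE eqE; rewrite -mulnn => leE eqE.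
rewrite /= in eqE *.
split=> [|eqm]; first by lia.
have E20 : E2 = 0%N by lia.
have E30 : E3 = 0%N by lia.
split; first by lia.
- move=> g gB; move/eqP: E30; rewrite sum_nat_eq0 => /forall_inP/(_ g gB).
  by rewrite subn_eq0.
- move=> g gB; move/eqP: E20; rewrite sum_nat_eq0 => /forall_inP/(_ g gB).
  by rewrite subn_eq0.
Qed.

(** The case [s = 1] of Pollard's theorem, in a form that avoids the minimum with
the order of the group: if [Z] misses a point [g], then [X] and [g - Y] are
disjoint, so that [X] and [Y] are small enough for Pollard's theorem. *)
Lemma cauchy_davenport X Y Z : X != set0 -> Y != set0 -> Z != setT ->
  (forall x y, x \in X -> y \in Y -> x + y \in Z) ->
  (#|X| + #|Y| <= #|Z| + 1)%N.
Proof.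
rewrite -!card_gt0 => X0 Y0 ZT addZ.
have reps0 g : g \notin Z -> reps X Y g = 0%N.
  move=> gZ; apply/eqP; rewrite sum_nat_eq0; apply/forallP => x /=.
  apply: contraR gZ; rewrite muln_eq0 !eqb0 negb_or !negbK => /andP[xX yY].
  by rewrite -(subrK x g) addrC addZ.
have leXY : (#|X| + #|Y| <= #|G|)%N.
  have /subsetPn[g _ gZ] : ~~ (setT \subset Z).
    by apply: contra ZT => ZT; rewrite -subTset.
  have dXY : [disjoint X & shift g (oppset Y)].
    apply/pred0P => x /=; rewrite !inE opprB; apply/negP => /andP[xX yY].
    by case/negP: gZ; rewrite -(subrK x g) addrC addZ.
  rewrite -(card_oppset Y) -(card_shift g (oppset Y)) -cardsUI.
  by move: dXY; rewrite -setI_eq0 => /eqP ->; rewrite cards0 addn0 max_card.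
have := pollard prime_G X0 Y0 (leq_trans leXY (leq_addr _ _)).
rewrite mul1n leq_subLR => /leq_trans; apply; rewrite addnC leq_add2r.
rewrite -sum1_card [leqRHS]big_mkcond; apply: leq_sum => g _.
by case: ifPn => [_|/reps0 ->]; rewrite ?minn0 ?geq_minl.
Qed.

End PrimeDist.

Section Odd.
Variable G : finZmodType.
Hypothesis odd_G : odd #|G|.
Implicit Types (S : {set G}) (x y : G).

Lemma oppr_eqF x : x != 0 -> - x != x.
Proof.
move=> nz_x; apply/eqP => xN.
have: (#[x]%g %| #|[set: G]|)%N by apply: (cardSg (subsetT <[x]>%G)).
rewrite cardsT => dvd_x.
have: (#[x]%g %| 2)%N by rewrite order_dvdn FinRing.zmodXgE mulr2n -{1}xN addNr.
rewrite dvdn_divisors // inE => /orP[|].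
  by rewrite order_eq1 => /eqP x0; case/eqP: nz_x.
rewrite inE => /eqP ox.
by move: odd_G dvd_x; rewrite ox dvdn2 => ->.
Qed.

(** Nonzero elements pair up with their distinct opposites. *)
Lemma odd_card_sym S : {in S, forall x, - x \in S} -> 0 \in S -> odd #|S|.
Proof.
have [n] := ubnP #|S|; elim: n => // n IHn in S *; rewrite ltnS => leS symS S0.
have [S1|] := boolP (S \subset [set 0]).
  have -> : S = [set 0] by apply/eqP; rewrite eqEsubset S1 sub1set.
  by rewrite cards1.
case/subsetPn => x xS; rewrite inE => nz_x.
rewrite (cardsD1 x) xS (cardsD1 (- x)) !inE symS // oppr_eqF //= negbK.
have ltS : (#|S :\ x :\ - x| < #|S|)%N.
  by rewrite (cardsD1 x S) xS add1n ltnS subset_leq_card // subsetDl.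
apply: IHn; first exact: leq_trans ltS leS.
  move=> y; rewrite !inE => /and3P[y1 y2 yS].
  by rewrite symS // andbT eqr_opp y2 eqr_oppLR y1.
by rewrite !inE S0 andbT !(eq_sym 0) oppr_eq0 nz_x.
Qed.

End Odd.

(** * Sets of extremal growth are progressions *)

Section Core.
Variable G : finZmodType.
Hypothesis prime_G : prime #|G|.
Hypothesis odd_G : odd #|G|.
Implicit Types (B S Z : {set G}) (x y : G).

(** The multiples [i * x] with [|i| < n]. *)
Definition symprog x n : {set G} :=
  [set y | [exists i : 'I_n, (y == x *+ i) || (y == - (x *+ i))]].

Lemma symprogP x n y :
  reflect (exists2 i, (i < n)%N & y = x *+ i \/ y = - (x *+ i)) (y \in symprog x n).
Proof.
rewrite inE; apply: (iffP existsP) => [[i /pred2P yi]|[i lt_in yi]].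
  by exists i.
by exists (Ordinal lt_in); apply/pred2P.
Qed.

Lemma symprogS x n : symprog x n.+1 = symprog x n :|: [set x *+ n; - (x *+ n)].
Proof.
apply/setP => y; apply/symprogP/setUP => [[i lt_in yi]|[/symprogP[i lt_in yi]|]].
- have [eq_in|ne_in] := eqVneq i n.
    by right; rewrite !inE -eq_in; apply/pred2P.
  by left; apply/symprogP; exists i => //; rewrite ltn_neqAle ne_in.
- by exists i => //; apply: ltnW.
- by rewrite !inE => /pred2P; exists n.
Qed.

(** Let [n] be the first exponent with [x *+ n] outside [S]. Then [x *+ n] and its
opposite lie in [Z] outside [S], so they are all that [Z] adds to [S].
If [x *+ n.+1] were in [S], then [Z] would be closed under translation by [x],
hence everything. So the elements of [S] off the central run of multiples of [x]
can neither leave [S] nor join that run under translation by [x]; a nonempty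
set of them would be the whole group. *)
Lemma sym_eq_symprog S Z x :
  x != 0 -> 0 \in S -> {in S, forall y, - y \in S} -> {in Z, forall y, - y \in Z} ->
  S \subset Z -> {in S, forall y, y + x \in Z} ->
  (#|Z| <= #|S| + 2)%N -> Z != setT ->
  exists n, S = symprog x n /\ Z = symprog x n.+1.
Proof.
move=> nz_x S0 symS symZ sSZ addZ leZ ZT.
have ST : S != setT.
  by apply: contraNneq ZT => ST; rewrite eqEsubset subsetT -ST.
have ex_n : exists n, x *+ n \notin S.
  have /subsetPn[g _ gS] : ~~ (setT \subset S).
    by apply: contra ST => ST; rewrite -subTset.
  by have [n def_g] := mulrn_surj prime_G g nz_x; exists n; rewrite -def_g.
case: (ex_minnP ex_n) => n eS min_n; exists n.
have inS i : (i < n)%N -> x *+ i \in S.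
  by apply: contraTT => /min_n; rewrite -leqNgt.
have inSN i : (i < n)%N -> - (x *+ i) \in S by move=> /inS /symS.
set e := x *+ n in eS.
have NeS : - e \notin S by apply: contra eS => /symS; rewrite opprK.
have [k def_n] : exists k, n = k.+1.
  exists n.-1; rewrite prednK // lt0n.
  by apply: contraNneq eS => n0; rewrite /e n0 mulr0n.
have lt_kn : (k < n)%N by rewrite def_n.
have def_e : e = x *+ k + x by rewrite /e def_n mulrSr.
have eZ : e \in Z by rewrite def_e addZ ?inS.
have nz_e : e != 0 by apply: contraNneq eS => ->.
have defZ : Z = S :|: [set e; - e].
  apply/eqP; rewrite eq_sym eqEcard; apply/andP; split.
    apply/subsetP => y; rewrite !inE => /or3P[yS|/eqP->|/eqP->] //.
      exact: (subsetP sSZ).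
    exact: symZ.
  rewrite cardsU cards2 (eq_sym e) oppr_eqF //= (_ : S :&: _ = set0).
    by rewrite cards0 subn0.
  apply/setP => y; rewrite !inE; apply/negP => /andP[yS /pred2P[] def_y];
    by move: yS; rewrite def_y ?(negPf eS) ?(negPf NeS).
have n1S : x *+ n.+1 \notin S.
  apply: contra ZT => n1S; apply/eqP.
  apply: (closed_translate prime_G nz_x); first by apply/set0Pn; exists e.
  move=> y; rewrite {1}defZ !inE => /or3P[|/eqP->|/eqP->]; first exact: addZ.
    by apply: (subsetP sSZ); rewrite -mulrSr.
  by apply: (subsetP sSZ); rewrite def_e opprD subrK inSN.
have sPS : symprog x n \subset S.
  by apply/subsetP => y /symprogP[i lt_in [] ->]; [apply: inS | apply: inSN].
have eqS : S = symprog x n; last by split=> //; rewrite symprogS -eqS.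
apply/eqP; rewrite eqEsubset sPS andbT -setD_eq0; apply: contraNT ST => W0.
rewrite eqEsubset subsetT andTb.
have <- := closed_translate prime_G nz_x W0; first exact: subsetDl.
move=> y /setDP[yS yP].
have yN i : (i < n)%N -> y <> - (x *+ i.+1).
  move=> lt_in def_y; have [def_i|ne_i] := eqVneq i.+1 n.
    by case/negP: NeS; rewrite /e -def_i -def_y.
  case/negP: yP; apply/symprogP; exists i.+1; last by right.
  by rewrite ltn_neqAle ne_i.
have := addZ y yS; rewrite defZ in_setU in_set2 => /orP[yxS|/pred2P[yx|yx]].
- apply/setDP; split=> //; apply/symprogP => -[i lt_in [] yx].
    case: i => [|i] in lt_in yx.
      by apply: (yN 0%N lt_in); rewrite -(addrK x y) yx mulr0n add0r.
    case/negP: yP; apply/symprogP; exists i; first exact: ltnW.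
    by left; rewrite -(addrK x y) yx mulrSr addrK.
  by apply: (yN i lt_in); rewrite -(addrK x y) yx mulrSr opprD.
- case/negP: yP; apply/symprogP; exists k => //.
  by left; rewrite -(addrK x y) yx def_e addrK.
- case/negP: n1S; rewrite -[x *+ _]opprK symS //.
  suff <- : y = - (x *+ n.+1) by [].
  by rewrite -(addrK x y) yx mulrSr opprD.
Qed.

Lemma dball0_eq B : B != set0 -> B != setT -> dball B 0 = [set 0].
Proof.
move=> B0 BT; apply/setP => g; rewrite !inE leqn0.
by apply/eqP/eqP => [|->]; [apply: dist_eq0 | apply: dist0].
Qed.

(** The balls of radii [k] and [t - k] are shown to satisfy Cauchy-Davenport with
equality on average over [k], hence for each [k]. At the radius just below
the first nontrivial ball, this makes the sequence of balls stationary up to the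
radius [t], so that translation by an element [x] of the first nontrivial ball
maps the ball of radius [t] into the ball of radius [t + 1]. *)
Lemma dball_symprog B t :
  (0 < t)%N -> (t.*2.+1 <= #|B| <= t.*2.+2)%N -> (#|B| + t.+2 <= #|G|)%N ->
  (\sum_g (t.+1 - dist B g) = t.+1 ^ 2)%N -> dball B t \subset B ->
  #|dball B t| = t.*2.+1 /\
  exists2 x, x != 0 &
    exists n, dball B t = symprog x n /\ dball B t.+1 = symprog x n.+1.
Proof.
move=> t_gt0 /andP[geB leB] leG; rewrite sum_dball => sum1 sDB.
have B0 : B != set0 by rewrite -card_gt0; lia.
have neT Z : (#|Z| < #|G|)%N -> Z != setT.
  by apply: contraTneq => ->; rewrite cardsT ltnn.
have BT : B != setT by apply: neT; move: leG; lia.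
have le0 : (\sum_(k < t) #|dball B k| <= t ^ 2)%N.
  by rewrite -sum_dball; apply: sum_subn_dist_le => //; lia.
have le2 : (\sum_(k < t.+2) #|dball B k| <= t.+2 ^ 2)%N.
  by rewrite -sum_dball; apply: sum_subn_dist_le => //; lia.
have odd_ball k : odd #|dball B k|.
  by apply: odd_card_sym => //; [apply: dball_opp | apply: dball0].
have cardt : #|dball B t| = t.*2.+1.
  have := leq_trans (subset_leq_card sDB) leB; have := odd_ball t.
  move: sum1 le0; rewrite big_ord_recr /= -!mulnn.
  by set c := #|dball B t|; set u := (\sum_(k < t) _)%N; lia.
split=> //.
have cardt1 : (#|dball B t.+1| <= #|dball B t| + 2)%N.
  by move: le2; rewrite big_ord_recr /= sum1 cardt -!mulnn; lia.
have dtT : dball B t != setT by apply: neT; rewrite cardt; move: geB leG; lia.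
have dt1T : dball B t.+1 != setT.
  by apply: neT; apply: leq_ltn_trans cardt1 _; rewrite cardt; move: geB leG; lia.
have ball_gt0 k : (0 < #|dball B k|)%N by apply/card_gt0P; exists 0; apply: dball0.
(* Cauchy-Davenport, as the two balls add up into the ball of radius [t]. *)
have leCD k : (k <= t)%N -> (#|dball B k| + #|dball B (t - k)| <= t.*2.+2)%N.
  move=> le_kt; rewrite -[t.*2.+2]addn1 -cardt.
  apply: cauchy_davenport => //; rewrite -?card_gt0 //.
  by move=> y z yD zD; rewrite -(subnKC le_kt); apply: dball_add.
(* The bounds [2 * t + 2] add up to twice the total size of the balls. *)
have eqCD (k : 'I_t.+1) : (#|dball B k| + #|dball B (t - k)| = t.*2.+2)%N.
  have sum2 : (\sum_(i < t.+1) (#|dball B i| + #|dball B (t - i)|) = t.+1 * t.*2.+2)%N.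
    rewrite big_split /= sum1 [X in (_ + X)%N](reindex_inj rev_ord_inj) /=.
    rewrite (eq_bigr (fun i : 'I_t.+1 => #|dball B i|)) => [|i _].
      by rewrite sum1 -mulnn; lia.
    by rewrite subSS subKn // -ltnS.
  have sum3 : (\sum_(i < t.+1) (t.*2.+2 - (#|dball B i| + #|dball B (t - i)|)) = 0)%N.
    apply/eqP; rewrite -(eqn_add2r (t.+1 * t.*2.+2)) -{1}sum2 -big_split /=.
    rewrite (eq_bigr (fun=> t.*2.+2)) ?sum_nat_const ?card_ord // => i _.
    by rewrite subnK // leCD // -ltnS.
  move/eqP: sum3; rewrite sum_nat_eq0 => /forallP/(_ k) /=; rewrite subn_eq0.
  by move=> ge; apply/eqP; rewrite eqn_leq ge leCD // -ltnS.
have ex_k : exists k, (1 < #|dball B k|)%N by exists t; rewrite cardt; lia.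
case: (ex_minnP ex_k) => k0 gt1 min_k0.
have k0t : (k0 <= t)%N by apply: min_k0; rewrite cardt; lia.
have ball0 := dball0_eq B0 BT.
case: k0 => [|j] in gt1 min_k0 k0t; first by rewrite ball0 cards1 in gt1.
have cardj : #|dball B j| = 1%N.
  apply/eqP; rewrite eqn_leq ball_gt0 andbT leqNgt.
  by apply/negP => /min_k0; rewrite ltnn.
have eqD : dball B (t - j) = dball B t.
  apply/eqP; rewrite eqEcard dball_sub ?leq_subr //= cardt.
  by have := eqCD (Ordinal (leqW k0t : (j < t.+1)%N)); rewrite /= cardj add1n => -[->].
have [x xD nz_x] : exists2 x, x \in dball B j.+1 & x != 0.
  case/card_gt1P: gt1 => x [y [xD yD ne_xy]].
  by have [x0|nz_x] := eqVneq x 0; [exists y; rewrite // -x0 eq_sym | exists x].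
exists x => //; apply: sym_eq_symprog => //.
- exact: dball0.
- by move=> y; apply: dball_opp.
- by move=> y; apply: dball_opp.
- exact: dball_sub.
- move=> y; rewrite -eqD => yD.
  have -> : t.+1 = (t - j + j.+1)%N by rewrite addnS subnK // ltnW.
  exact: dball_add.
Qed.
End Core.

(** * Centred intervals in the integers modulo p *)

Section ZModP.
Variable p : nat.
Hypothesis p_prime : prime p.
Hypothesis p_odd : odd p.
Implicit Types (B J : {set 'Z_p}) (x y : 'Z_p) (b k n : nat).

Let p_gt1 : (1 < p)%N := prime_gt1 p_prime.

Lemma card_Zmodp : #|'Z_p| = p.
Proof. by rewrite card_ord Zp_cast. Qed.

Let prime_Zp : prime #|'Z_p|. Proof. by rewrite card_Zmodp. Qed.
Let odd_Zp : odd #|'Z_p|. Proof. by rewrite card_Zmodp. Qed.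

(** The sequence [0, -1, 1, -2, 2, ...], which is the enumeration [xelt p] read
backwards from [xelt p p = 0]. *)
Definition alt k : 'Z_p :=
  if odd k then - (uphalf k)%:R else (uphalf k)%:R.

Definition alt_set b : {set 'Z_p} := [set alt i | i : 'I_b].

Lemma alt_setP b y : reflect (exists2 k, (k < b)%N & y = alt k) (y \in alt_set b).
Proof.
apply: (iffP imsetP) => [[k _ ->]|[k lt_kb ->]]; first by exists k.
by exists (Ordinal lt_kb).
Qed.

Lemma alt_setS b : alt_set b.+1 = alt b |: alt_set b.
Proof.
apply/setP => y; rewrite in_setU1; apply/alt_setP/predU1P.
  case=> k; rewrite ltnS leq_eqVlt => /predU1P[-> ->|lt_kb ->]; first by left.
  by right; apply/alt_setP; exists k.
case=> [->|/alt_setP[k lt_kb ->]]; first by exists b.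
by exists k; rewrite // ltnW.
Qed.

Lemma natZp_inj m n : (m < p)%N -> (n < p)%N -> m%:R = n%:R :> 'Z_p -> m = n.
Proof.
by move=> lt_m lt_n /(congr1 val) /=; rewrite !val_Zp_nat // !modn_small.
Qed.

Lemma opp_natZp n : (n <= p)%N -> - n%:R = (p - n)%N%:R :> 'Z_p.
Proof. by move=> le_n; rewrite natrB // pchar_Zp // add0r. Qed.

Lemma alt_nat k : (k < p)%N ->
  alt k = (if odd k then p - uphalf k else uphalf k)%N%:R.
Proof.
by move=> lt_kp; rewrite /alt; case: ifP => // _; rewrite opp_natZp //; lia.
Qed.

Lemma alt_inj k n : (k < p)%N -> (n < p)%N -> alt k = alt n -> k = n.
Proof.
move=> lt_k lt_n; rewrite !alt_nat // => /natZp_inj.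
by do 2!case: ifP => //; lia.
Qed.

Lemma card_alt_set b : (b <= p)%N -> #|alt_set b| = b.
Proof.
move=> le_bp; rewrite card_imset ?card_ord // => i j eq_ij; apply: val_inj.
by apply: alt_inj eq_ij; apply: leq_trans le_bp.
Qed.

Lemma alt_set_full : alt_set p = setT.
Proof.
by apply/eqP; rewrite eqEcard subsetT cardsT card_Zmodp card_alt_set leqnn.
Qed.

Lemma alt_surj y : exists2 k, (k < p)%N & y = alt k.
Proof. by apply/alt_setP; rewrite alt_set_full inE. Qed.

Lemma alt_set_sub b n : (b <= n)%N -> alt_set b \subset alt_set n.
Proof.
move=> le_bn; apply/subsetP => y /alt_setP[k lt_kb ->].
by apply/alt_setP; exists k; first exact: leq_trans le_bn.
Qed.

Lemma xelt_alt k : (k < p)%N -> xelt p (p - k) = alt k.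
Proof.
move=> lt_kp; rewrite /xelt oddB ?p_odd; last exact: ltnW.
rewrite alt_nat // addTb; case: (boolP (odd k)) => odd_k /=.
  by rewrite -natrD; congr (_%:R); lia.
by rewrite -natrB; [congr (_%:R) | ]; lia.
Qed.

(** The sequence [alt] enumerates the whole ring in its first [p] terms, and its
first [p - a] terms are the last [p - a] of the enumeration [xelt p]. *)
Lemma initial_setC a : (a <= p)%N -> initial_set p a = ~: alt_set (p - a).
Proof.
move=> le_ap; apply/setP => y; rewrite inE; apply/imsetP/negP.
  move=> [i _ ->] /alt_setP[k lt_k]; have lt_i := ltn_ord i.
  have -> : i.+1 = (p - (p - i.+1))%N by lia.
  by rewrite xelt_alt => [/alt_inj|]; lia.
move=> notJ; have [k lt_kp def_y] := alt_surj y.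
have le_k : (p - a <= k)%N.
  rewrite leqNgt; apply/negP => lt_k; case: notJ.
  by apply/alt_setP; exists k.
have lt_i : (p - k.+1 < a)%N by lia.
exists (Ordinal lt_i) => //=; rewrite def_y -xelt_alt //; congr (xelt p _); lia.
Qed.

(** An interval loses only its least element on subtracting [1]. In the alternating
enumeration this is the term with the last odd index, or [alt 0] if [b = 1]. *)
Lemma dist_alt_set1 b : (dist (alt_set b) 1%R <= 1)%N.
Proof.
rewrite -(cards1 (alt (b./2.*2.-1))); apply/subset_leq_card/subsetP => y.
rewrite !inE => /andP[nJ /alt_setP[i lt_ib def_y]]; apply/eqP.
rewrite def_y in nJ *; congr alt.
have notJ k : alt i - 1 = alt k -> (b <= k)%N.
  move=> eq_k; rewrite leqNgt; apply: contra nJ => lt_kb.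
  by apply/alt_setP; exists k.
have [odd_i|even_i] := boolP (odd i).
  suff : (b <= i.+2)%N by lia.
  apply: notJ; rewrite /alt /= !negbK odd_i -opprD -natr1.
  by congr (- _); rewrite natr1.
case: i => [|[|i]] // in lt_ib nJ notJ even_i def_y *.
  suff : (b <= 1)%N by lia.
  by apply: notJ; rewrite /alt /= sub0r.
suff : (b <= i)%N by lia.
apply: notJ; rewrite /alt /= !negbK in even_i *.
by rewrite (negPf even_i) -[(uphalf i).+1%:R]natr1 addrK.
Qed.

Lemma dist_alt_set b k : (dist (alt_set b) (alt k) <= uphalf k)%N.
Proof.
have dist_nat n : (dist (alt_set b) n%:R%R <= n)%N.
  elim: n => [|n IHn]; first by rewrite mulr0n dist0.
  rewrite -natr1 -[n.+1]addn1; apply: leq_trans (distD _ _ _) _.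
  by rewrite leq_add ?dist_alt_set1.
by rewrite /alt; case: ifP => _; rewrite ?distN.
Qed.

Lemma sum_uphalf b : (\sum_(k < b) uphalf k = uphalf b * (b - uphalf b))%N.
Proof.
elim: b => [|b IHb]; first by rewrite big_ord0.
rewrite big_ord_recr /= IHb.
have [q] : exists q, (b = q.*2 \/ b = q.*2.+1)%N by exists b./2; lia.
by case=> ->; rewrite /= ?uphalf_double ?doubleK //; nia.
Qed.

Lemma sum_dist_alt_set b : (b <= p)%N ->
  (\sum_(g in alt_set b) dist (alt_set b) g <= uphalf b * (b - uphalf b))%N.
Proof.
move=> le_bp; rewrite -sum_uphalf big_imset /=; last first.
  move=> i j _ _ eq_ij; apply: val_inj.
  by apply: alt_inj eq_ij; apply: leq_trans le_bp.
by apply: leq_sum => k _; apply: dist_alt_set.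
Qed.

Lemma sum_dist_lb B b : #|B| = b -> (3 * b + 2 <= 2 * p)%N ->
  (uphalf b * (b - uphalf b) <= \sum_(g in B) dist B g)%N.
Proof.
move=> cardB leb; have [||ge _] := @sum_dist_ge _ prime_Zp B (uphalf b).
- by rewrite cardB; lia.
- by rewrite cardB card_Zmodp; lia.
by rewrite mulnBr leq_subLR mulnn; move: ge; rewrite cardB.
Qed.

(** The lower bound for [\sum_(g in B) dist B g] meets the upper bound for the
interval, so the interval has the most Schur triples, in known number. *)
Lemma ST_alt_set_max B b : #|B| = b -> (3 * b + 2 <= 2 * p)%N ->
  (ST B <= ST (alt_set b))%N /\
  (ST (alt_set b) + uphalf b * (b - uphalf b) = b * b)%N.
Proof.
move=> cardB leb; have le_bp : (b <= p)%N by lia.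
have := sum_dist_alt_set le_bp; have := sum_dist_lb cardB leb.
have := sum_dist_lb (card_alt_set le_bp) leb.
have := ST_dist B; have := ST_dist (alt_set b); rewrite cardB card_alt_set //.
set s := (\sum_(g in B) _)%N; set s' := (\sum_(g in alt_set b) _)%N.
by move: (b * b)%N (uphalf b * _)%N; lia.
Qed.

Lemma unit_Zp x : x != 0 -> x \is a GRing.unit.
Proof.
move=> nz_x; have lt_xp : (x < p)%N by rewrite -[ltnRHS](Zp_cast p_gt1).
have x_gt0 : (0 < x)%N by rewrite lt0n.
by rewrite -(natr_Zp x) unitZpE // prime_coprime // gtnNdvd.
Qed.

Lemma symprog_alt_set x n :
  symprog x n.+1 = [set x * y | y in alt_set n.*2.+1].
Proof.
apply/setP => y; apply/symprogP/imsetP => [[i lt_in yi]|[_ /alt_setP[k lt_k ->] ->]].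
  case: yi => ->.
    exists (alt i.*2); first by apply/alt_setP; exists i.*2 => //; lia.
    by rewrite /alt odd_double uphalf_double mulr_natr.
  exists (alt i.*2.-1); first by apply/alt_setP; exists i.*2.-1 => //; lia.
  case: i {lt_in} => [|i]; first by rewrite /alt /= mulr0 mulr0n oppr0.
  by rewrite doubleS /alt /= odd_double /= doubleK mulrN mulr_natr.
exists (uphalf k); first by lia.
by rewrite /alt; case: ifP => _; [right | left]; rewrite ?mulrN mulr_natr.
Qed.

Lemma symprogN (G : finZmodType) (x : G) n : symprog (- x) n = symprog x n.
Proof.
apply/setP => y; rewrite !inE; apply: eq_existsb => i.
by rewrite mulNrn opprK orbC.
Qed.

Lemma card_scale x B : x != 0 -> #|[set x * y | y in B]| = #|B|.
Proof. by move=> /unit_Zp /mulrI xI; rewrite card_imset. Qed.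

(** With [t = uphalf b - 1], the set [B] lies between the ball of radius [t], which
is the progression of the [i * x] with [|i| <= t], and the ball of radius [t + 1].
If [b] is odd, then [B] is the smaller ball; if [b] is even, it has one point
more, which is [- x * (t + 1)] after a possible change of sign of [x]. *)
Lemma sum_dist_eq B b : #|B| = b -> (0 < b)%N -> (3 * b + 2 <= 2 * p)%N ->
  (\sum_(g in B) dist B g = uphalf b * (b - uphalf b))%N ->
  exists2 x, x != 0 & B = [set x * y | y in alt_set b].
Proof.
move=> cB b_gt0 leB eqB; set m := uphalf b.
have [||_ []] := @sum_dist_ge _ prime_Zp B m.
- by rewrite cB /m; lia.
- by rewrite cB card_Zmodp /m; lia.
- by rewrite eqB cB -/m mulnBr -mulnn subnKC // leq_mul2l /m; lia.
rewrite {}/m; have [t def_m] : exists t, uphalf b = t.+1.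
  by exists (uphalf b).-1; lia.
rewrite def_m => sum_m geB ltB.
have cardB : (t.*2.+1 <= b <= t.*2.+2)%N by lia.
have sDB : dball B t \subset B.
  by apply/subsetP => g; rewrite inE; apply: contraTT => /ltB; rewrite -ltnNge.
have sBD : B \subset dball B t.+1 by apply/subsetP => g /geB; rewrite inE.
have B0 : B != set0 by rewrite -card_gt0 cB.
have BT : B != setT.
  by apply: contraTneq leB => BT; rewrite -cB BT cardsT card_Zmodp -ltnNge; lia.
have [x nz_x [defD sBx]] :
    exists2 x, x != 0 & dball B t = symprog x t.+1 /\ B \subset symprog x t.+2.
  (* For [t = 0], nothing links the ball of radius [1] to a progression, but then
     [B] is [0] with at most one further point, which serves as [x]. *)
  case: t => [|t] in def_m sum_m geB ltB cardB sDB sBD *.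
    have sym1 x : symprog x 1 = [set 0].
      apply/setP => y; rewrite in_set1; apply/symprogP/eqP => [[[|i] // _ []]|->].
      - by rewrite mulr0n.
      - by rewrite mulr0n oppr0.
      - by exists 0%N => //; left.
    have defD x : dball B 0 = symprog x 1 by rewrite sym1 (dball0_eq prime_Zp).
    have B_0 : 0 \in B by apply: (subsetP sDB); apply: dball0.
    have [sB0|/subsetPn[e eB]] := boolP (B \subset [set 0]).
      exists 1; first exact: oner_neq0.
      by split=> //; rewrite symprogS sym1 subsetU ?sB0.
    rewrite inE => nz_e; exists e => //; split=> //.
    rewrite symprogS sym1 (_ : B = [set 0; e]).
      by rewrite subUset !sub1set !inE eqxx mulr1n eqxx !orbT.
    apply/eqP; rewrite eq_sym eqEcard subUset !sub1set B_0 eB cards2 eq_sym nz_e cB.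
    by case/andP: cardB.
  have [|||cardD [x nz_x [n [defD defD1]]]] // :=
    dball_symprog prime_Zp odd_Zp _ _ _ sum_m sDB.
  - by rewrite cB.
  - by rewrite cB card_Zmodp; lia.
  (* The length is determined by the size of the ball: with more than [p] terms
     the progression would have [p] elements. *)
  exists x => //; suff eq_n : n = t.+2 by rewrite -eq_n -defD1.
  move: n defD {defD1} => [|n] defD.
    have := dball0 B t.+1; rewrite defD => /symprogP[] //.
  move: cardD; rewrite defD symprog_alt_set card_scale //.
  have [le_np|lt_pn] := leqP n.*2.+1 p; first by rewrite card_alt_set //; lia.
  by have := subset_leq_card (alt_set_sub (ltnW lt_pn)); rewrite card_alt_set //; lia.
have symE := symprog_alt_set x t.
have cardD : #|dball B t| = t.*2.+1.
  by rewrite defD symE card_scale // card_alt_set //; lia.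
have [eq_b|ne_b] := eqVneq b t.*2.+1.
  exists x; rewrite // eq_b -symE -defD; apply/eqP.
  by rewrite eq_sym eqEcard sDB cardD cB eq_b leqnn.
have {cardB ne_b} eq_b : b = t.*2.+2 by lia.
have [e eB eD] : exists2 e, e \in B & e \notin dball B t.
  by apply/subsetPn; apply/negP => /subset_leq_card; rewrite cardD cB eq_b ltnn.
have defB : B = e |: dball B t.
  apply/eqP; rewrite eq_sym eqEcard subUset sub1set eB sDB cardsU1 eD cardD cB eq_b.
  by rewrite add1n leqnn.
have altt : alt t.*2.+1 = - t.+1%:R.
  by rewrite /alt /= odd_double /= doubleK.
have fromN z : z != 0 -> symprog z t.+1 = dball B t -> e = - (z *+ t.+1) ->
    exists2 x, x != 0 & B = [set x * y | y in alt_set b].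
  move=> nz_z defDz def_e; exists z => //; rewrite eq_b alt_setS imsetU1.
  by rewrite -symprog_alt_set defDz altt mulrN mulr_natr -def_e.
have := subsetP sBx e eB; rewrite symprogS -defD in_setU (negPf eD) in_set2.
case/pred2P => def_e; last exact: (fromN x).
by apply: (fromN (- x)); rewrite ?oppr_eq0 // ?symprogN // mulNrn opprK.
Qed.

End ZModP.

(** * The minimum and its equality case *)

Lemma floor_ceil_half (p a b : nat) : (a + b)%N = p ->
  Num.floor ((3 * a%:R - p%:R) / 2 : rat) = a%:Z - (uphalf b)%:Z /\
  Num.ceil ((3 * a%:R - p%:R) / 2 : rat) = a%:Z - b./2%:Z.
Proof.
move=> <-; have eq_b : (b%:R = b./2%:R + (uphalf b)%:R :> rat).
  by rewrite -natrD; congr _%:R; lia.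
have ge0 : (b./2%:R <= (uphalf b)%:R :> rat) by rewrite ler_nat; lia.
have le1 : ((uphalf b)%:R <= b./2%:R + 1 :> rat) by rewrite natr1 ler_nat; lia.
rewrite natrD eq_b; split; [apply: floor_def | apply: ceil_def];
  by rewrite !(intrD, intrB) -!pmulrn; lra.
Qed.

Section Final.
Variable p : nat.
Hypothesis p_prime : prime p.
Hypothesis p_odd : odd p.

Let p_gt1 : (1 < p)%N := prime_gt1 p_prime.

Lemma card_initial_set a : (a <= p)%N -> #|initial_set p a| = a.
Proof.
move=> le_ap; rewrite initial_setC // cardsCs setCK card_Zmodp //.
by rewrite card_alt_set ?leq_subr // subKn.
Qed.

(** The centre of the interval is [(p - 1) / 2]; doubling representatives avoids
halves in the bounds on them. *)
Lemma initial_set_coord a (x : 'Z_p) : (a <= p)%N -> x \in initial_set p a ->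
  exists i v, [/\ (i < a)%N, x = v%:R &
    v.*2 = if odd i then (p + i)%N else (p - i.+1)%N].
Proof.
move=> le_ap /imsetP[i _ ->]; have lt_ip : (i < p)%N by apply: leq_trans le_ap.
have lt_k : (p - i.+1 < p)%N by lia.
have -> : xelt p i.+1 = alt p (p - i.+1).
  by rewrite -xelt_alt //; congr (xelt p _); lia.
exists i; rewrite alt_nat //; eexists; split; [by [] | reflexivity |].
by do 2!case: ifP; lia.
Qed.

(** The representatives below [p] lie strictly between [p / 3] and [2 * p / 3]: a
sum of two of them is too large to be one of them and too small to be one of
them plus [p]. *)
Lemma ST_initial_set_eq0 a : (3 * a <= p + 1)%N -> ST (initial_set p a) = 0%N.
Proof.
move=> le_a; have le_ap : (a <= p)%N by lia.
apply/eqP; rewrite cards_eq0; apply/eqP/setP => -[[x y] z]; rewrite inE in_set0 /=.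
apply/negP => /and4P[xI yI zI /eqP].
have [i [x' [lt_i -> eq_x]]] := initial_set_coord le_ap xI.
have [j [y' [lt_j -> eq_y]]] := initial_set_coord le_ap yI.
have [k [z' [lt_k -> eq_z]]] := initial_set_coord le_ap zI.
rewrite -natrD => /(congr1 val) /=; rewrite !val_Zp_nat // => eq_mod.
have lt_z : (z' < p)%N by move: eq_z; case: ifP; lia.
rewrite (modn_small lt_z) in eq_mod.
have [lt_xy|le_xy] := ltnP (x' + y') p.
  by move: eq_mod eq_x eq_y eq_z; rewrite modn_small //; do 3!case: ifP; lia.
move: eq_mod; rewrite -(subnK le_xy) modnDr modn_small.
  by move: eq_x eq_y eq_z; do 3!case: ifP; lia.
by move: eq_x eq_y; do 2!case: ifP; lia.
Qed.

Lemma scale_setC (x : 'Z_p) (B : {set 'Z_p}) : x != 0 ->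
  [set x * y | y in ~: B] = ~: [set x * y | y in B].
Proof.
move=> /(unit_Zp p_prime) Ux; have xI := mulrI Ux.
apply/setP => z; rewrite -(mulVKr Ux z) inE.
by rewrite !(mem_imset _ _ xI) inE.
Qed.

Lemma scale_Aut (x : 'Z_p) (J : {set 'Z_p}) : x != 0 ->
  exists2 phi : {perm 'Z_p}, phi \in Aut [set: 'Z_p] &
    [set x * y | y in J] = phi @: J.
Proof.
move=> /(unit_Zp p_prime)/mulrI xI; exists (perm xI).
  rewrite inE; apply/andP; split; first by apply/subsetP => y _; rewrite inE.
  by apply/morphicP => y z _ _; rewrite !permE; apply: mulrDr.
by apply: eq_imset => y; rewrite permE.
Qed.

End Final.
Theorem theorem1p3 (p : nat) (p_prime : prime p) (p_odd : odd p)
    (A : {set 'Z_p}) (a : nat) (card_A : #|A| = a) :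
  [/\ (ST (initial_set p a) <= ST A)%N,
      (ST (initial_set p a))%:Z =
        (if a%:R <= (p%:R + 1) / 3 :> rat then 0
         else Num.floor ((3 * a%:R - p%:R) / 2 : rat)
              * Num.ceil ((3 * a%:R - p%:R) / 2 : rat))
    & (0 < ST (initial_set p a))%N -> ST A = ST (initial_set p a) ->
      (exists2 phi : {perm 'Z_p},
          phi \in Aut [set: 'Z_p] & A = phi @: initial_set p a)
      /\ (exists2 xi : 'Z_p,
          xi != 0 & A = [set xi * x | x in initial_set p a])].
Proof.
pose b := #|~: A|.
have eq_ab : (a + b)%N = p by rewrite /b -card_A cardsC card_Zmodp.
have le_ap : (a <= p)%N by lia.
have le_bp : (b <= p)%N by lia.
have -> : (a%:R <= (p%:R + 1) / 3 :> rat) = (3 * a <= p + 1)%N.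
  rewrite ler_pdivlMr // -(natrD _ p 1) -natrM ler_nat mulnC //.
have [small|large] := leqP (3 * a) (p + 1).
  by rewrite ST_initial_set_eq0.
have lt_b : (3 * b + 2 <= 2 * p)%N by lia.
have defI : initial_set p a = ~: alt_set p b.
  by rewrite initial_setC // -eq_ab addKn.
have [leST eqST] := ST_alt_set_max p_prime p_odd (erefl b) lt_b.
have ST_A : (ST A + ST (~: A) + a * b = a ^ 2 + b ^ 2)%N.
  by have := ST_setC (~: A); rewrite setCK card_A.
have ST_I : (ST (initial_set p a) + ST (alt_set p b) + a * b = a ^ 2 + b ^ 2)%N.
  have := ST_setC (alt_set p b); rewrite -defI card_initial_set //.
  by rewrite card_alt_set.
split.
- by move: leST ST_A ST_I; rewrite -/b; lia.
- have [-> ->] := floor_ceil_half eq_ab.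
  have [h [u [def_h def_u def_b]]] :
      exists h u, [/\ b./2 = h, uphalf b = u & b = h + u]%N.
    by exists b./2, (uphalf b); split=> //; lia.
  move: eqST ST_I; rewrite def_h def_u def_b addnK => eqST ST_I.
  by nia.
move=> _ eq_ST; suff [xi nz_xi def_A] : exists2 xi : 'Z_p,
    xi != 0 & A = [set xi * x | x in initial_set p a].
  split; last by exists xi.
  by rewrite def_A; apply: scale_Aut.
have [b0|b_gt0] := posnP b.
  have J0 : alt_set p b = set0 by apply/eqP; rewrite -cards_eq0 card_alt_set // b0.
  have A0 : ~: A = set0 by apply/eqP; rewrite -cards_eq0 -/b b0.
  exists 1; rewrite ?oner_neq0 // defI J0 -[A]setCK A0 -[LHS]imset_id.
  by apply: eq_imset => x; rewrite mul1r.
have ST_B : ST (~: A) = ST (alt_set p b) by lia.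
have [|x nz_x defB] := sum_dist_eq p_prime p_odd (erefl b) b_gt0 lt_b.
  have := ST_dist (~: A); rewrite -/b ST_B -eqST.
  exact: addnI.
by exists x; rewrite // defI scale_setC // -defB setCK.
Qed.
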